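(* Let $f:\mathbb{R}^n\to\mathbb{R}$ be twice continuously differentiable with $\gamma$-Lipschitz continuous Hessian ($\gamma>0$) and strongly convex with parameter $\lambda>0$, and let $x_*$ be its minimizer. Let $\{z_s\}_{s\ge0}$ be generated by the multi-stage AINCR algorithm described in the context, where in every stage the Hessian approximations satisfy \[ \frac{\mu_t}{2}I\preceq H_t-\nabla^2 f(w_t)\preceq\mu_tI,\qquad 0\le\mu_t\le\mu_u,\qquad\forall t\ge0 . \] Then, for any $s\ge0$, \[ \|z_s-x_*\|^2\le\left(\frac12\right)^sR_0^2,\qquad f(z_s)-f(x_* )\le\left(\frac14\right)^s[f(z_0)-f(x_* )]. \]
   Context: $\|\cdot\|$ is the Euclidean norm for vectors and the spectral norm for matrices; $\preceq$ is the Loewner order. The Hessian of $f$ is $\gamma$-Lipschitz if $\|\nabla^2 f(x)-\nabla^2 f(x')\|\le\gamma\|x-x'\|$ for all $x,x'$. The function $f$ is strongly convex with parameter $\lambda$ if $f(\alpha x+(1-\alpha)x')\le\alpha f(x)+(1-\alpha)f(x')-\frac{\alpha(1-\alpha)\lambda}{2}\|x-x'\|^2$ for all $x,x'$, $\alpha\in[0,1]$. Inner algorithm (AINCR, run with strong convexity parameter $0$). Starting from $x_0\in\mathbb{R}^n$, use the parameters $\alpha_t=\frac{3}{t+3}$, $\bar\mu_t=2\mu_u(t+2)$ $(t\ge0)$, $\beta=96\gamma$, $\eta=4\gamma$, and put $A_0=1$, $A_t=\prod_{i=1}^t(1-\alpha_i)$ for $t\ge1$. For $t\ge0$, $H_t$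 is a symmetric matrix approximating $\nabla^2 f(w_t)$, and for $c>0$, \[ \tilde f_c(x;w_t)=f(w_t)+\langle\nabla f(w_t),x-w_t\rangle+\tfrac12\langle H_t(x-w_t),x-w_t\rangle+\tfrac{c}{6}\|x-w_t\|^3 . \] Set $w_0=x_0$, $x_1=\arg\min_x\tilde f_\gamma(x;x_0)$, $\phi_1(x)=f(x_1)+\frac{\bar\mu_0}{2}\|x-x_0\|^2+\frac{\beta}{6}\|x-x_0\|^3$, $y_1=\arg\min_x\phi_1(x)$. For $t=1,2,\dots$: \[ w_t=(1-\alpha_t)x_t+\alpha_ty_t,\qquad x_{t+1}=\arg\min_x\tilde f_\eta(x;w_t), \] \[ \phi_{t+1}(x)=\phi_t(x)+\frac{\bar\mu_t-\bar\mu_{t-1}}{2}\|x-x_0\|^2+\frac{\alpha_t}{A_t}\big[f(x_{t+1})+\langle\nabla f(x_{t+1}),x-x_{t+1}\rangle\big],\qquad y_{t+1}=\arg\min_x\phi_{t+1}(x). \] Multi-stage AINCR algorithm. Input: $z_0\in\mathbb{R}^n$, $\lambda>0$, $\gamma>0$, $\mu_u\ge0$, and $R_0>0$ with $\|z_0-x_*\|\le R_0$. For $s=1,2,\dots$: set $x_0=z_{s-1}$ and $R_s=R_0/2^s$; run the inner algorithm from $x_0$ for $T_s$ iterations, where \[ T_s=\left\lceil 2\max\left\{\left(\frac{196\gamma R_{s-1}}{\lambda}\right)^{1/3},\ 2\left(\frac{6\mu_u}{\lambda}\right)^{1/2}\right\}\right\rceil ; \] set $z_s=x_{T_s}$. 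*)

(* Defs.v *)
From HB Require Import structures.
From mathcomp Require Export all_boot all_order all_algebra.
From mathcomp Require Export all_classical all_reals all_analysis.
Export numFieldNormedType.Exports.

Set Implicit Arguments.
Unset Strict Implicit.
Unset Printing Implicit Defensive.

Import Order.TTheory GRing.Theory Num.Theory.
Local Open Scope classical_set_scope.
Local Open Scope ring_scope.

(* R^n is 'rV[R]_n, and matrices act on row vectors from the right, as for the
   library's Jacobian.  The library's norm on 'rV[R]_n is the sup norm: it is
   used below only through its topology, as the Euclidean norm is [enorm]. *)

Definition dotp (R : realType) (n : nat) (u v : 'rV[R]_n) : R :=
  \sum_(i < n) u 0 i * v 0 i.

Definition enorm (R : realType) (n : nat) (u : 'rV[R]_n) : R :=
  Num.sqrt (dotp u u).

(* The supremum is over a nonempty bounded set, so [sup] is not a default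
   value here. *)
Definition spectral_norm (R : realType) (n : nat) (A : 'M[R]_n) : R :=
  sup [set enorm (v *m A) | v in [set v : 'rV[R]_n | enorm v <= 1]].

(* The Loewner order; it is meant for symmetric matrices. *)
Definition loewner_le (R : realType) (n : nat) (A B : 'M[R]_n) : Prop :=
  forall v : 'rV[R]_n, 0 <= dotp (v *m (B - A)) v.

Definition gradient (R : realType) (n : nat) (f : 'rV[R]_n -> R)
    (x : 'rV[R]_n) : 'rV[R]_n :=
  \row_(i < n) 'D_(delta_mx 0 i) f x.

Definition hessian (R : realType) (n : nat) (f : 'rV[R]_n -> R)
    (x : 'rV[R]_n) : 'M[R]_n :=
  'J (gradient f) x.

Definition twice_continuously_differentiable (R : realType) (n : nat)
    (f : 'rV[R]_n -> R) : Prop :=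
  [/\ forall x, differentiable f x,
      forall x, differentiable (gradient f) x
    & continuous (hessian f)].

Definition lipschitz_hessian (R : realType) (n : nat) (gamma : R)
    (f : 'rV[R]_n -> R) : Prop :=
  forall x x' : 'rV[R]_n,
    spectral_norm (hessian f x - hessian f x') <= gamma * enorm (x - x').

Definition strongly_convex (R : realType) (n : nat) (lambda : R)
    (f : 'rV[R]_n -> R) : Prop :=
  forall (x x' : 'rV[R]_n) (a : R), 0 <= a <= 1 ->
    f (a *: x + (1 - a) *: x') <=
      a * f x + (1 - a) * f x'
      - a * (1 - a) * lambda / 2 * enorm (x - x') ^+ 2.

Definition is_argmin (R : realType) (n : nat) (g : 'rV[R]_n -> R)
    (x : 'rV[R]_n) : Prop :=
  forall u : 'rV[R]_n, g x <= g u.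

Definition alpha (R : realType) (t : nat) : R := 3 / (t%:R + 3).

Definition mubar (R : realType) (mu_u : R) (t : nat) : R :=
  2 * mu_u * (t%:R + 2).

Definition aprod (R : realType) (t : nat) : R :=
  \prod_(1 <= i < t.+1) (1 - alpha R i).

(* [cubic_model f c H w] is the function x |-> \tilde f_c(x; w). *)
Definition cubic_model (R : realType) (n : nat) (f : 'rV[R]_n -> R) (c : R)
    (H : 'M[R]_n) (w x : 'rV[R]_n) : R :=
  f w + dotp (gradient f w) (x - w)
  + 2^-1 * dotp ((x - w) *m H) (x - w) + c / 6 * enorm (x - w) ^+ 3.

(* [estimate f gamma mu_u x0 x t] is phi_t for t >= 1, with beta = 96 gamma;
   its value at t = 0 is junk. *)
Fixpoint estimate (R : realType) (n : nat) (f : 'rV[R]_n -> R)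
    (gamma mu_u : R) (x0 : 'rV[R]_n) (x : nat -> 'rV[R]_n) (t : nat)
    (u : 'rV[R]_n) {struct t} : R :=
  match t with
  | 0%N => 0
  | 1%N => f (x 1%N) + mubar mu_u 0%N / 2 * enorm (u - x0) ^+ 2
         + (96 * gamma) / 6 * enorm (u - x0) ^+ 3
  | (r.+1 as t').+1 =>
      estimate f gamma mu_u x0 x t' u
      + (mubar mu_u t' - mubar mu_u r) / 2 * enorm (u - x0) ^+ 2
      + alpha R t' / aprod R t'
        * (f (x t'.+1) + dotp (gradient f (x t'.+1)) (u - x t'.+1))
  end.

(* [T] iterations (producing x_1, ..., x_T) of the inner algorithm from x0,
   with eta = 4 gamma; entries of the sequences past these iterations are
   unconstrained. *)
Record inner_run (R : realType) (n : nat) (f : 'rV[R]_n -> R)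
    (gamma mu_u : R) (x0 : 'rV[R]_n) (T : nat)
    (H : nat -> 'M[R]_n) (w x y : nat -> 'rV[R]_n) : Prop := InnerRun {
  run_sym : forall t, (t < T)%N -> (H t)^T = H t;
  run_x0 : x 0%N = x0;
  run_w0 : w 0%N = x0;
  run_x1 : is_argmin (cubic_model f gamma (H 0%N) (w 0%N)) (x 1%N);
  run_y : forall t, (0 < t <= T)%N ->
    is_argmin (estimate f gamma mu_u x0 x t) (y t);
  run_w : forall t, (0 < t < T)%N ->
    w t = (1 - alpha R t) *: x t + alpha R t *: y t;
  run_xS : forall t, (0 < t < T)%N ->
    is_argmin (cubic_model f (4 * gamma) (H t) (w t)) (x t.+1)
}.

Definition radius (R : realType) (R0 : R) (s : nat) : R := R0 / 2 ^+ s.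

(* T_s, for s >= 1; the ceiling is that of a nonnegative real, so taking its
   absolute value only casts it from int to nat. *)
Definition stage_length (R : realType) (lambda gamma mu_u R0 : R)
    (s : nat) : nat :=
  absz (Num.ceil (2 * Num.max
    ((196 * gamma * radius R0 s.-1 / lambda) `^ (1 / 3))
    (2 * (6 * mu_u / lambda) `^ (1 / 2)))).

(* The first argument of H, w, x and y is the stage s >= 1, the second one the
   inner iteration. *)
Definition multistage_run (R : realType) (n : nat) (f : 'rV[R]_n -> R)
    (z0 : 'rV[R]_n) (lambda gamma mu_u R0 : R) (z : nat -> 'rV[R]_n)
    (H : nat -> nat -> 'M[R]_n) (w x y : nat -> nat -> 'rV[R]_n) : Prop :=
  z 0%N = z0 /\
  forall s, (0 < s)%N ->
    inner_run f gamma mu_u (z s.-1) (stage_length lambda gamma mu_u R0 s)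
      (H s) (w s) (x s) (y s) /\
    z s = x s (stage_length lambda gamma mu_u R0 s).

(* Main.v *)
Require Import Defs.
From mathcomp Require Import ring lra.

Set Implicit Arguments.
Unset Strict Implicit.
Unset Printing Implicit Defensive.

Import Order.TTheory GRing.Theory Num.Theory.
Local Open Scope classical_set_scope.
Local Open Scope ring_scope.

(** Why the theorem is true. The proof is Nesterov's estimating sequence
argument for cubic regularisation, restarted with a halved radius.

Inside one stage, [phi_t] is a quadratic plus cubic function of the distance
to [x_0] plus an affine function. Two invariants link it to [f]:
- [f (x_t) / A_(t-1) <= phi_t u] for all [u] ([value_le_estimate]);
- [phi_t u] is at most [f u / A_(t-1)] plus
  [(mubar_(t-1) + mu_u) / 2 * D^2 + 49 / 3 * gamma * D^3], where [D] is the
  distance from [u] to [x_0] ([estimate_le]).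
Taken at [u = xstar] they bound [f (x_T) - f xstar] by [A_(T-1)] times that
polynomial in [D] ([inner_run_le]).

The second invariant only uses convexity of [f], the first step, and
[1 / A_t + alpha_(t+1) / A_(t+1) = 1 / A_(t+1)]. The first one is the heart of
the proof. The function [phi_t] grows around its minimiser [y_t] at least like
[mubar_(t-1) / 2 * r^2 + 8 * gamma * r^3] ([cubic_growth],
[norm_cubic_uconvex]), and the cubic step from [w_t] satisfies, for every
vector [d],
  [0 <= <grad f (x_(t+1)), w_t - x_(t+1) + d> + mu / 4 * |d|^2
        + 16 / 9 * gamma * |d|^3]
([cubic_step_progress]); with [d = alpha_t * (u - y_t)] the growth of [phi_t]
pays for the two last terms, because [A_t] is at least [2 / 9 * alpha_t^3] and
[A_t * mubar_(t-1) / 2] at least [2 / 3 * mu_u * alpha_t^2].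

Over a whole stage, [A_(T-1)] is at most [6 / T^3], and the length of the stage
is chosen so that the bound becomes [lambda / 8 * D^2] ([stage_rate]). Strong
convexity gives [lambda / 2 * |z - xstar|^2 <= f z - f xstar]: applied to the new
point it halves the distance to [xstar], so that the radius used by the next
stage is valid, and applied to the old point it divides the gap in function
value by four. The distance therefore even decreases like [R_0 / 2^s]. *)

(** * The Euclidean norm *)

Section Euclid.
Variables (R : realType) (n : nat).
Implicit Types (u v w : 'rV[R]_n) (a : R) (A : 'M[R]_n).

Lemma dotpC u v : dotp u v = dotp v u.
Proof. by apply: eq_bigr => i _; rewrite mulrC. Qed.

Lemma dotpDl u v w : dotp (u + v) w = dotp u w + dotp v w.
Proof. by rewrite -big_split; apply: eq_bigr => i _; rewrite mxE mulrDl. Qed.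

Lemma dotpZl a u v : dotp (a *: u) v = a * dotp u v.
Proof. by rewrite mulr_sumr; apply: eq_bigr => i _; rewrite mxE mulrA. Qed.

Lemma dotpDr u v w : dotp w (u + v) = dotp w u + dotp w v.
Proof. by rewrite dotpC dotpDl !(dotpC w). Qed.

Lemma dotpZr a u v : dotp u (a *: v) = a * dotp u v.
Proof. by rewrite dotpC dotpZl dotpC. Qed.

Lemma dotpNl u v : dotp (- u) v = - dotp u v.
Proof. by rewrite -scaleN1r dotpZl mulN1r. Qed.

Lemma dotpNr u v : dotp u (- v) = - dotp u v.
Proof. by rewrite dotpC dotpNl dotpC. Qed.

Lemma dotp0l v : dotp 0 v = 0.
Proof. by rewrite -(scale0r 0) dotpZl mul0r. Qed.

Definition dotpE := (dotpDl, dotpDr, dotpNl, dotpNr, dotpZl, dotpZr).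

Lemma dotp_mulmx u v A : dotp (u *m A) v = dotp u (v *m A^T).
Proof.
have dotp_mx u' v' : dotp u' v' = (u' *m v'^T) 0 0.
  by rewrite mxE; apply: eq_bigr => i _; rewrite mxE.
by rewrite !dotp_mx trmx_mul trmxK mulmxA.
Qed.

Lemma dotp_ge0 u : 0 <= dotp u u.
Proof. by apply: sumr_ge0 => i _; rewrite -expr2 sqr_ge0. Qed.

Lemma enorm_ge0 u : 0 <= enorm u. Proof. exact: sqrtr_ge0. Qed.

Lemma sqr_enorm u : enorm u ^+ 2 = dotp u u.
Proof. by rewrite sqr_sqrtr // dotp_ge0. Qed.

Lemma enormZ a u : enorm (a *: u) = `|a| * enorm u.
Proof.
by rewrite /enorm dotpZl dotpZr mulrA -expr2 sqrtrM ?sqr_ge0 // sqrtr_sqr.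
Qed.

Lemma enormN u : enorm (- u) = enorm u.
Proof. by rewrite -scaleN1r enormZ normrN1 mul1r. Qed.

Lemma enormB u v : enorm (u - v) = enorm (v - u).
Proof. by rewrite -enormN opprB. Qed.

Lemma enorm_eq0 u : enorm u = 0 -> u = 0.
Proof.
move=> u0; have : dotp u u = 0 by rewrite -sqr_enorm u0 expr0n.
move/eqP; rewrite psumr_eq0 => [/allP uu0|i _]; last by rewrite -expr2 sqr_ge0.
apply/rowP => i; rewrite mxE; apply/eqP.
by have := uu0 i (mem_index_enum i); rewrite /= -expr2 sqrf_eq0.
Qed.

Lemma dotp_le u v : dotp u v <= enorm u * enorm v.
Proof.
have [u0|u0] := eqVneq (enorm u) 0.
  by rewrite u0 (enorm_eq0 u0) dotp0l mul0r.
have [v0|v0] := eqVneq (enorm v) 0.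
  by rewrite v0 (enorm_eq0 v0) dotpC dotp0l mulr0.
have up : 0 < enorm u by rewrite lt_def u0 enorm_ge0.
have vp : 0 < enorm v by rewrite lt_def v0 enorm_ge0.
have := dotp_ge0 (enorm v *: u - enorm u *: v).
rewrite !dotpE (dotpC v u) -!sqr_enorm => h.
have {h} : 0 <= (enorm u * enorm v) * (enorm u * enorm v - dotp u v) by lra.
by rewrite pmulr_rge0 ?mulr_gt0 // subr_ge0.
Qed.

Lemma dotp_ge u v : - (enorm u * enorm v) <= dotp u v.
Proof. by rewrite lerNl -dotpNl -(enormN u) dotp_le. Qed.

Lemma enormD u v : enorm (u + v) <= enorm u + enorm v.
Proof.
rewrite -(@ler_pXn2r _ 2) ?nnegrE ?addr_ge0 ?enorm_ge0 //.
rewrite sqr_enorm !dotpE (dotpC v u) -!sqr_enorm.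
have := dotp_le u v; lra.
Qed.

Lemma norm_sub_enorm u v : `|enorm (u + v) - enorm u| <= enorm v.
Proof.
have := enormD u v; have := enormD (u + v) (- v).
rewrite addrK enormN => h1 h2; rewrite ler_norml; apply/andP; split; lra.
Qed.

(** The supremum defining the spectral norm is finite because, by
Cauchy-Schwarz in each column, the image of the unit ball is bounded by the
norm of the vector of the column norms. *)
Lemma enorm_mulmx_le v A : enorm (v *m A) <= spectral_norm A * enorm v.
Proof.
have col_le u : enorm u <= 1 ->
    enorm (u *m A) <= Num.sqrt (\sum_(j < n) enorm (col j A)^T ^+ 2).
  move=> u1; rewrite ler_wsqrtr //; apply: ler_sum => j _; rewrite -expr2.
  have -> : (u *m A) 0 j = dotp u (col j A)^T.
    by rewrite mxE; apply: eq_bigr => i _; rewrite !mxE.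
  have h1 := dotp_le u (col j A)^T; have h2 := dotp_ge u (col j A)^T.
  have cj := enorm_ge0 (col j A)^T; have u0 := enorm_ge0 u.
  rewrite -ler_sqrt ?sqr_ge0 // !sqrtr_sqr (ger0_norm cj) ler_norml.
  apply/andP; split; nra.
have [v0|v0] := eqVneq (enorm v) 0.
  rewrite v0 (enorm_eq0 v0) mul0mx mulr0 -(scale0r (0 : 'rV[R]_n)).
  by rewrite enormZ normr0 mul0r.
have vp : 0 < enorm v by rewrite lt_def v0 enorm_ge0.
have nv : enorm ((enorm v)^-1 *: v) <= 1.
  by rewrite enormZ ger0_norm ?invr_ge0 ?enorm_ge0 // mulVf.
rewrite -ler_pdivrMr //.
have -> : enorm (v *m A) / enorm v = enorm (((enorm v)^-1 *: v) *m A).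
  by rewrite -scalemxAl enormZ ger0_norm ?invr_ge0 ?enorm_ge0 // mulrC.
apply: sup_upper_bound; last by exists ((enorm v)^-1 *: v).
split; first by exists (enorm (((enorm v)^-1 *: v) *m A)), ((enorm v)^-1 *: v).
exists (Num.sqrt (\sum_(j < n) enorm (col j A)^T ^+ 2)) => _ [u u1 <-].
exact: col_le.
Qed.

(** First-order expansion of the cube of the norm at [u]. With [a = enorm u],
[b = enorm (u + v)] and [r = enorm v], the remainder is
[(b - a)^2 * (b + a / 2) + 3 / 2 * a * r^2], where [|b - a| <= r]. *)
Lemma norm_cubic_bound u v :
  enorm (u + v) ^+ 3 - enorm u ^+ 3 - 3 * enorm u * dotp u v
    <= (3 * enorm u + enorm v) * enorm v ^+ 2.
Proof.
have uv : dotp u v = (enorm (u + v) ^+ 2 - enorm u ^+ 2 - enorm v ^+ 2) / 2.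
  by rewrite !sqr_enorm !dotpE (dotpC v u); lra.
have := norm_sub_enorm u v; rewrite ler_norml uv.
move: (enorm_ge0 u) (enorm_ge0 v) (enorm_ge0 (u + v)).
move: (enorm u) (enorm v) (enorm (u + v)) => a r b a0 r0 b0 /andP[h1 h2].
have -> : b ^+ 3 - a ^+ 3 - 3 * a * ((b ^+ 2 - a ^+ 2 - r ^+ 2) / 2) =
  (b - a) ^+ 2 * (b + a / 2) + 3 / 2 * a * r ^+ 2 by field.
have sq : (b - a) ^+ 2 <= r ^+ 2 by nra.
have : (b - a) ^+ 2 * (b + a / 2) <= r ^+ 2 * (3 / 2 * a + r).
  by apply: ler_pM; rewrite ?sqr_ge0 //; lra.
lra.
Qed.

(** Uniform convexity of the cube of the norm. In the notation of
[norm_cubic_bound], the claim is that [r^2 * (3 * a - r) / 2] is at least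
[- (b - a)^2 * (b + a / 2)]. Only [r > 3 * a] is a threat; there
[r^2 * (3 * a - r)] decreases in [r], so its worst value is at the collinear
configuration [r = a + b], where the sum is [(b - a)^3 / 2 + 2 * a^3]. *)
Lemma norm_cubic_uconvex u v :
  enorm v ^+ 3 / 2
    <= enorm (u + v) ^+ 3 - enorm u ^+ 3 - 3 * enorm u * dotp u v.
Proof.
have uv : dotp u v = (enorm (u + v) ^+ 2 - enorm u ^+ 2 - enorm v ^+ 2) / 2.
  by rewrite !sqr_enorm !dotpE (dotpC v u); lra.
have := norm_sub_enorm u v; rewrite ler_norml uv.
have := enormD (u + v) (- u); rewrite addrAC subrr add0r enormN.
move: (enorm_ge0 u) (enorm_ge0 v) (enorm_ge0 (u + v)).
move: (enorm u) (enorm v) (enorm (u + v)) => a r b a0 r0 b0 h3 /andP[h1 h2].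
have -> : b ^+ 3 - a ^+ 3 - 3 * a * ((b ^+ 2 - a ^+ 2 - r ^+ 2) / 2) =
  (b - a) ^+ 2 * (b + a / 2) + 3 / 2 * a * r ^+ 2 by field.
have [r3|r3] := leP r (3 * a).
  have : 0 <= r ^+ 2 * (3 * a - r) by rewrite mulr_ge0 ?sqr_ge0 //; lra.
  have : 0 <= (b - a) ^+ 2 * (b + a / 2) by rewrite mulr_ge0 ?sqr_ge0 //; lra.
  lra.
have : r ^+ 2 * (r - 3 * a) <= (a + b) ^+ 2 * (b - 2 * a).
  apply: ler_pM; rewrite ?sqr_ge0 //; try lra.
  by rewrite ler_pXn2r ?nnegrE //; lra.
have : 0 <= a ^+ 3 by rewrite exprn_ge0.
have : 0 <= (b - a) ^+ 3 by rewrite exprn_ge0 //; lra.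
nra.
Qed.
End Euclid.

(** * Taylor bounds from a Lipschitz Hessian *)

(** The passage to the limit in all first-order arguments below: perturb along
[e *: d], divide by [e], and let [e] tend to [0]. *)
Lemma ge0_of_small (R : realType) (a C : R) :
  (forall e, 0 < e <= 1 -> - (C * e) <= a) -> 0 <= a.
Proof.
move=> ha; rewrite leNgt; apply/negP => a0.
have C0 := normr_ge0 C; have CC := ler_norm C.
have d0 : 0 < `|C| + 1 - a by lra.
have e0 : 0 < - a / (`|C| + 1 - a) by apply: divr_gt0 => //; lra.
have := ha (- a / (`|C| + 1 - a)); rewrite e0 ler_pdivrMr // mul1r.
have -> : - a <= `|C| + 1 - a by lra.
move=> /(_ isT).
have e1 : (- a / (`|C| + 1 - a)) * (`|C| + 1 - a) = - a.
  by rewrite divfK // gt_eqF.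
move: (- a / _) e0 e1 => e e0 e1 h; nra.
Qed.

Section Calculus.
Variables (R : realType) (n : nat).
Implicit Types (f : 'rV[R]_n -> R) (u v w h d : 'rV[R]_n).

(** The mean value theorem applied to the difference of [F] and the polynomial
[a * t + b * t^2 + c * t^3]; this stands in for integrating the bound on the
derivative. *)
Lemma increment_le (F F' : R -> R) (a b c : R) :
  (forall t : R, is_derive t 1 F (F' t)) ->
  (forall t, 0 < t < 1 -> F' t <= a + 2 * b * t + 3 * c * t ^+ 2) ->
  F 1 - F 0 <= a + b + c.
Proof.
pose Q : {poly R} := a *: 'X + b *: 'X^2 + c *: 'X^3.
have Q01 : Q.[1] - Q.[0] = a + b + c by rewrite /Q !hornerE /=; ring.
have Q' t : Q^`().[t] = a + 2 * b * t + 3 * c * t ^+ 2.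
  by rewrite /Q !derivD !derivZ derivX !derivXn !hornerE /=; ring.
move=> dF hF; rewrite -Q01.
have dG (t : R) : is_derive t 1 (F \- horner Q) (F' t - Q^`().[t]).
  by apply: is_deriveB.
have [||k] := @MVT R (F \- horner Q) (fun t => F' t - Q^`().[t]) 0 1.
- exact: ltr01.
- apply: derivable_within_continuous => t _.
  exact: (@ex_derive _ _ _ _ _ _ _ (dG t)).
rewrite in_itv /= => /hF; rewrite -Q'; lra.
Qed.

(** Both derivatives are limits of the same difference quotient. *)
Lemma is_derive_line (V : normedModType R) (g : 'rV[R]_n -> V) w h (t : R) :
  differentiable g (w + t *: h) ->
  is_derive t (1 : R) (fun s => g (w + s *: h)) ('D_h g (w + t *: h)).
Proof.
move=> dg0; have dg : derivable g (w + t *: h) h by exact: diff_derivable.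
have E : (fun s => s^-1 *: (((fun s => g (w + s *: h)) \o shift t)
                     (s *: (1 : R)) - g (w + t *: h)))
   = (fun s =>
      s^-1 *: ((g \o shift (w + t *: h)) (s *: h) - g (w + t *: h))).
  apply/funext => s /=; congr (_ *: (g _ - _)).
  by rewrite [s%:A]mulr1 scalerDl addrCA.
by split; [rewrite /derivable E | rewrite /derive E].
Qed.

Lemma derive_gradient f x v :
  differentiable f x -> 'D_v f x = dotp (gradient f x) v.
Proof.
move=> df; rewrite deriveE // [in LHS](row_sum_delta v) linear_sum.
apply: eq_bigr => i _; rewrite linearZ /= mxE -deriveE //.
by rewrite [_ *: _]mulrC.
Qed.

Lemma is_derive_dotp (g : R -> 'rV[R]_n) (g' d : 'rV[R]_n) (t : R) :
  is_derive t 1 g g' -> is_derive t 1 (fun s => dotp (g s) d) (dotp g' d).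
Proof.
move=> dg; have dgi i : is_derive t 1 (fun s => g s 0 i) (g' 0 i).
  have dv := @ex_derive _ _ _ _ _ _ _ dg.
  split; first by move/derivable_mxP: dv.
  by move: (derive_mx dv); rewrite derive_val => ->; rewrite mxE.
have -> : (fun s => dotp (g s) d) = \sum_(i < n) (d 0 i *: (fun s => g s 0 i)).
  apply/funext => s; rewrite fct_sumE.
  by apply: eq_bigr => i _; rewrite mulrC.
have -> : dotp g' d = \sum_(i < n) d 0 i *: g' 0 i.
  by apply: eq_bigr => i _; rewrite mulrC.
by apply: is_derive_sum => i; exact: is_deriveZ.
Qed.

Variables (f : 'rV[R]_n -> R) (gamma : R).
Hypothesis f_C2 : twice_continuously_differentiable f.
Hypothesis f_lip : lipschitz_hessian gamma f.

Lemma hessian_increment_le x h v d :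
  dotp (v *m (hessian f (x + h) - hessian f x)) d
    <= gamma * enorm h * enorm v * enorm d.
Proof.
apply: le_trans (dotp_le _ _) _; rewrite ler_wpM2r ?enorm_ge0 //.
apply: le_trans (enorm_mulmx_le _ _) _; rewrite ler_wpM2r ?enorm_ge0 //.
by have := f_lip (x + h) x; rewrite (_ : x + h - x = h) // addrC addKr.
Qed.

(** The remainder is tested against a vector [d] to reduce it to a real
function of one variable; taking [- d] gives the opposite bound. *)
Lemma gradient_taylor x h d :
  dotp (gradient f (x + h) - gradient f x - h *m hessian f x) d
    <= gamma / 2 * enorm h ^+ 2 * enorm d.
Proof.
case: f_C2 => _ dg _.
have := @increment_le (fun s => dotp (gradient f (x + s *: h)) d)
  (fun s => dotp (h *m hessian f (x + s *: h)) d)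
  (dotp (h *m hessian f x) d) (gamma / 2 * enorm h ^+ 2 * enorm d) 0.
rewrite scale1r scale0r !addr0 !dotpE => H.
suff : dotp (gradient f (x + h)) d - dotp (gradient f x) d <=
  dotp (h *m hessian f x) d + gamma / 2 * enorm h ^+ 2 * enorm d by lra.
apply: H => [t|t /andP[t0 t1]].
  rewrite -(deriveEjacobian h (dg (x + t *: h))).
  exact: is_derive_dotp (is_derive_line (dg (x + t *: h))).
rewrite mulr0 mul0r addr0 -lerBlDl.
rewrite -dotpNl -dotpDl -mulmxBr.
have := hessian_increment_le x (t *: h) h d.
by rewrite enormZ gtr0_norm //; lra.
Qed.

Lemma function_taylor x h :
  `|f (x + h) - f x - dotp (gradient f x) h - dotp (h *m hessian f x) h / 2|
    <= gamma / 6 * enorm h ^+ 3.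
Proof.
case: f_C2 => df _ _.
have dF e (t : R) : is_derive t 1 (fun s => e * f (x + s *: h))
     (e * dotp (gradient f (x + t *: h)) h).
  rewrite -derive_gradient //.
  have dl := is_derive_line (df (x + t *: h)).
  exact: (@is_deriveZ R R R (fun s : R => f (x + s *: h)) e t 1 _ dl).
(* The signs e = 1 and e = -1 give the two sides of the bound. *)
have key e : `|e| = 1 -> e * f (x + h) - e * f x <=
   e * dotp (gradient f x) h + e * dotp (h *m hessian f x) h / 2
   + gamma / 6 * enorm h ^+ 3.
  move=> e1; have := increment_le (dF e); rewrite scale1r scale0r addr0.
  apply=> t /andP[t0 t1].
  have := gradient_taylor x (t *: h) (e *: h).
  rewrite !enormZ e1 (gtr0_norm t0) -scalemxAl !dotpE.
  lra.
have := key 1 (normr1 _); have := key (-1) (normrN1 _) => k1 k2.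
rewrite ler_norml; apply/andP; split; lra.
Qed.
End Calculus.

(** * Cubic polynomials and their minimisers *)

Section CubicPolynomial.
Variables (R : realType) (n : nat).
Implicit Types (l u v d : 'rV[R]_n) (S : 'M[R]_n) (b c : R).

(** The common shape, in the displacement [u], of the models minimised by the
inner steps and of the estimating functions. *)
Definition cubic c l S b u : R :=
  c + dotp l u + 2^-1 * dotp (u *m S) u + b / 6 * enorm u ^+ 3.

(** The left factor is the gradient of the polynomial at [u]; a one-sided
condition for all [d] says that it vanishes and avoids differentiating the
norm. *)
Lemma cubic_variational c l S b u d :
  S^T = S -> 0 <= b -> is_argmin (cubic c l S b) u ->
  0 <= dotp (l + u *m S + (b / 2 * enorm u) *: u) d.
Proof.
move=> symS b0 umin.
apply: (@ge0_of_small _ _ (2^-1 * dotp (d *m S) d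
  + b / 6 * (3 * enorm u + enorm d) * enorm d ^+ 2)) => e /andP[e0 e1].
have := umin (u + e *: d); rewrite /cubic mulmxDl -scalemxAl !dotpE.
have -> : dotp (d *m S) u = dotp (u *m S) d by rewrite dotp_mulmx symS dotpC.
have := norm_cubic_bound u (e *: d).
rewrite enormZ (gtr0_norm e0) dotpZr => h1 h2.
have := ler_wpM2l b0 h1; move: (enorm_ge0 d) (enorm_ge0 u) => d0 u0 h3.
have h4 : (3 * enorm u + e * enorm d) * (e * enorm d) ^+ 2
   <= e ^+ 2 * ((3 * enorm u + enorm d) * enorm d ^+ 2).
  rewrite exprMn mulrCA ler_wpM2l ?sqr_ge0 // ler_wpM2r ?sqr_ge0 //.
  by rewrite lerD2l ler_piMl.
have h5 := ler_wpM2l b0 h4.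
rewrite -(ler_pM2l e0); lra.
Qed.

Lemma cubic_growth c l S b u d :
  S^T = S -> 0 <= b -> is_argmin (cubic c l S b) u ->
  cubic c l S b u + 2^-1 * dotp (d *m S) d + b / 12 * enorm d ^+ 3
    <= cubic c l S b (u + d).
Proof.
move=> symS b0 umin; have := cubic_variational d symS b0 umin.
have := ler_wpM2l b0 (norm_cubic_uconvex u d).
rewrite /cubic mulmxDl !dotpE.
have -> : dotp (d *m S) u = dotp (u *m S) d by rewrite dotp_mulmx symS dotpC.
lra.
Qed.
End CubicPolynomial.

(** * Symmetry of the Hessian and convexity *)

Section Smooth.
Variables (R : realType) (n : nat) (f : 'rV[R]_n -> R) (gamma : R).
Hypothesis f_C2 : twice_continuously_differentiable f.
Hypothesis f_lip : lipschitz_hessian gamma f.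
Implicit Types (x w u v d : 'rV[R]_n).

(** The increment of [f] from [x + u] to [x + u + v] can be expanded at [x]
or at [x + u]. The first expansion contains the symmetric part of the Hessian,
the second one, through the increment of the gradient, the Hessian itself;
they agree up to terms of order three. *)
Lemma hessian_asymmetry_le x u v :
  dotp (u *m hessian f x) v - dotp (v *m hessian f x) u
  <= gamma / 3 * (enorm u ^+ 3 + enorm v ^+ 3 + enorm (u + v) ^+ 3)
     + gamma * enorm u * enorm v * (enorm u + enorm v).
Proof.
have := function_taylor f_C2 f_lip x (u + v).
have := function_taylor f_C2 f_lip x u.
have := function_taylor f_C2 f_lip (x + u) v.
have := gradient_taylor f_C2 f_lip x u (- v).
have := hessian_increment_le f_lip x u (- v) v.
rewrite addrA !enormN.
move: (hessian f x) (hessian f (x + u)) => J J'.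
move: (gradient f x) (gradient f (x + u)) (f (x + u + v)) (f (x + u)).
move=> g g' c c'.
move: (enorm u) (enorm v) (enorm (u + v)) => p q r.
rewrite mulNmx mulmxBr mulmxDl !dotpE.
rewrite !ler_norml => h5 h4 /andP[h3 _] /andP[h2 _] /andP[_ h1].
lra.
Qed.

Lemma hessian_form_le x u v :
  dotp (u *m hessian f x) v <= dotp (v *m hessian f x) u.
Proof.
rewrite -subr_ge0.
apply: (@ge0_of_small _ _
  (gamma / 3 * (enorm u ^+ 3 + enorm v ^+ 3 + enorm (u + v) ^+ 3)
     + gamma * enorm u * enorm v * (enorm u + enorm v))) => e /andP[e0 e1].
have := hessian_asymmetry_le x (e *: u) (e *: v).
rewrite -scalerDr !enormZ (gtr0_norm e0).
move: (hessian f x) (enorm u) (enorm v) (enorm (u + v)) => J p q r.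
rewrite -!scalemxAl !dotpE => h.
have e2 : 0 < e ^+ 2 by rewrite exprn_gt0.
rewrite -(ler_pM2l e2).
lra.
Qed.

Lemma hessian_sym x : (hessian f x)^T = hessian f x.
Proof.
apply/matrixP => i j; rewrite mxE.
have E k l : dotp (delta_mx 0 k *m hessian f x) (delta_mx 0 l) = hessian f x k l.
  rewrite -rowE /dotp (bigD1 l) //= big1 => [|m ml].
    by rewrite !mxE !eqxx mulr1 addr0.
  by rewrite !mxE (negPf ml) andbF mulr0.
by rewrite -!E; apply/eqP; rewrite eq_le !hessian_form_le.
Qed.

(** Convexity between [x] and [x + d], evaluated at [x + e *: d]; the Taylor
expansion is used only to know that the quotient tends to the directional
derivative. *)
Lemma convex_gradient_le lambda x d :
  0 <= lambda -> strongly_convex lambda f ->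
  f x + dotp (gradient f x) d <= f (x + d).
Proof.
move=> lam0 fsc; rewrite -subr_ge0.
set q := dotp (d *m hessian f x) d.
apply: (@ge0_of_small _ _ (`|q / 2| + `|gamma / 6 * enorm d ^+ 3|)) => e.
move=> /andP[e0 e1].
have e01 : 0 <= e <= 1 by rewrite ltW.
have := fsc (x + d) x e e01.
have -> : e *: (x + d) + (1 - e) *: x = x + e *: d.
  by rewrite scalerDr scalerBl scale1r addrC addrA subrK.
have sc0 : 0 <= e * (1 - e) * lambda / 2 * enorm (x + d - x) ^+ 2.
  rewrite mulr_ge0 ?sqr_ge0 // divr_ge0 // mulr_ge0 //.
  by rewrite mulr_ge0 ?subr_ge0 ?(ltW e0).
have := function_taylor f_C2 f_lip x (e *: d).
rewrite enormZ (gtr0_norm e0) -scalemxAl !dotpE ler_norml => /andP[h1 _] h2.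
have := ler_norm (gamma / 6 * enorm d ^+ 3); have := ler_norm (- (q / 2)).
rewrite normrN => q1 q2.
have q3 := normr_ge0 (gamma / 6 * enorm d ^+ 3).
rewrite -(ler_pM2l e0); move: h1 h2 q1 q2 q3; rewrite -/q.
move: `|q / 2| `|gamma / 6 * _| => A B h1 h2 q1 q2 q3.
have e2 : 0 < e ^+ 2 by rewrite exprn_gt0.
have e3 : 0 < e ^+ 3 by rewrite exprn_gt0.
have p1 := ler_wpM2l (ltW e2) q1.
have p2 := ler_wpM2l (ltW e3) q2.
have p3 : e ^+ 3 * B <= e ^+ 2 * B.
  by rewrite ler_wpM2r // (exprS e 2) ler_piMl // ltW.
move: (enorm d) (dotp _ _) h1 h2 p2 => D G h1 h2 p2.
lra.
Qed.
End Smooth.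

(** Strong convexity at [e *: x + (1 - e) *: xs], where [f] is at least
[f xs]; then [e] tends to [0]. *)
Lemma strongly_convex_growth (R : realType) (n : nat) (f : 'rV[R]_n -> R)
    (lambda : R) (xs x : 'rV[R]_n) :
  strongly_convex lambda f -> is_argmin f xs ->
  lambda / 2 * enorm (x - xs) ^+ 2 <= f x - f xs.
Proof.
move=> fsc xsmin; rewrite -subr_ge0.
apply: (@ge0_of_small _ _ (lambda / 2 * enorm (x - xs) ^+ 2)) => e /andP[e0 e1].
have e01 : 0 <= e <= 1 by rewrite ltW.
have := fsc x xs e e01; have := xsmin (e *: x + (1 - e) *: xs) => h1 h2.
rewrite -(ler_pM2l e0); lra.
Qed.

(** * One cubic step *)

Lemma loewner_scalar_le (R : realType) (n : nat) (a : R) (A : 'M[R]_n) v :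
  loewner_le (a *: 1%:M) A -> a * enorm v ^+ 2 <= dotp (v *m A) v.
Proof.
move=> /(_ v); rewrite mulmxBr -scalemxAr mulmx1 !dotpE -sqr_enorm.
by rewrite subr_ge0.
Qed.

Lemma loewner_le_scalar (R : realType) (n : nat) (a : R) (A : 'M[R]_n) v :
  loewner_le A (a *: 1%:M) -> dotp (v *m A) v <= a * enorm v ^+ 2.
Proof.
move=> /(_ v); rewrite mulmxBr -scalemxAr mulmx1 !dotpE -sqr_enorm.
by rewrite subr_ge0.
Qed.

Section CubicStep.
Variables (R : realType) (n : nat) (f : 'rV[R]_n -> R) (gamma : R).
Hypothesis gamma_gt0 : 0 < gamma.
Hypothesis f_C2 : twice_continuously_differentiable f.
Hypothesis f_lip : lipschitz_hessian gamma f.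
Variables (mu : R) (H : 'M[R]_n) (w x1 : 'rV[R]_n).
Hypothesis mu_ge0 : 0 <= mu.
Hypothesis H_sym : H^T = H.
Hypothesis H_lower : loewner_le ((mu / 2) *: 1%:M) (H - hessian f w).
Hypothesis H_upper : loewner_le (H - hessian f w) (mu *: 1%:M).

(** The lower bound on [H] makes the model an upper bound of [f] at [x1], and
the upper bound on [H] limits its excess over [f] at [u]. *)
Lemma cubic_model_min_le :
  is_argmin (cubic_model f gamma H w) x1 ->
  forall u, f x1 <= f u + mu / 2 * enorm (u - w) ^+ 2
                    + gamma / 3 * enorm (u - w) ^+ 3.
Proof.
move=> x1min u; have := x1min u; rewrite /cubic_model.
have := function_taylor f_C2 f_lip w (x1 - w).
have := function_taylor f_C2 f_lip w (u - w).
have := loewner_scalar_le (x1 - w) H_lower.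
have := loewner_le_scalar (u - w) H_upper.
have : 0 <= mu * enorm (x1 - w) ^+ 2 by rewrite mulr_ge0 ?sqr_ge0.
rewrite !(addrC w) !subrK !mulmxBr.
move: (hessian f w) (gradient f w) => J g.
rewrite !(dotpDl, dotpNl) !ler_norml => h1 h2 h3 /andP[h4 _] /andP[_ h5].
lra.
Qed.

(** Put [h = x1 - w], [p = enorm h], [q = enorm d], and let [E] be the error of
[H]. Optimality of [x1] and the Taylor expansion write [gradient f x1] as
[- h *m E - (2 * gamma * p) *: h] up to [gamma / 2 * p^2]. The terms with [E]
and the quadratic term complete the square [<(h - d / 2) E, h - d / 2>], which
is where the symmetry of the Hessian enters. What is left is at least
[gamma * (3 / 2 * p^3 - 5 / 2 * p^2 * q + 16 / 9 * q^3)]. *)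
Lemma cubic_step_progress d :
  is_argmin (cubic_model f (4 * gamma) H w) x1 ->
  0 <= dotp (gradient f x1) (w - x1 + d) + mu / 4 * enorm d ^+ 2
       + 16 / 9 * gamma * enorm d ^+ 3.
Proof.
have [h x1E] : exists h, x1 = w + h by exists (x1 - w); rewrite addrC subrK.
move=> x1min.
have hmin : is_argmin (cubic (f w) (gradient f w) H (4 * gamma)) h.
  move=> v; have := x1min (w + v).
  by rewrite x1E /cubic_model /cubic !(addrC w) !addrK.
have g0 : 0 <= 4 * gamma by rewrite mulr_ge0 // ltW.
have := cubic_variational (d - h) H_sym g0 hmin.
have := gradient_taylor f_C2 f_lip w h (h - d).
rewrite -x1E.
have -> : w - x1 + d = d - h by rewrite x1E opprD addrA subrr add0r addrC.
have := loewner_le_scalar d H_upper.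
have := loewner_scalar_le (h - 2^-1 *: d) H_lower.
have := enormD h (- d); rewrite enormN.
have symE : dotp (d *m (H - hessian f w)) h = dotp (h *m (H - hessian f w)) d.
  by rewrite dotp_mulmx linearB /= H_sym (hessian_sym f_C2 f_lip) dotpC.
have hE : h *m H = h *m hessian f w + h *m (H - hessian f w).
  by rewrite mulmxBr addrC subrK.
rewrite hE; move: symE; move: (H - _) => E symE.
have : 0 <= mu / 2 * enorm (h - 2^-1 *: d) ^+ 2.
  by rewrite mulr_ge0 ?sqr_ge0 // divr_ge0.
move: (enorm (h - 2^-1 *: d)) => k.
move: (hessian f w) (gradient f w) (gradient f x1) => J g g1.
rewrite mulmxBl -scalemxAl !dotpE symE -sqr_enorm.
have := dotp_le h d; move: (enorm_ge0 h) (enorm_ge0 d).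
move: (enorm h) (enorm d) (enorm (h - d)) (dotp h d) => p q r hd p0 q0.
move=> hd_le k0 r_le E0 Emu taylor var.
(* For p = 1 the cubic form is minimal in q near 7/10; the certificate has a
   double zero there. *)
have cert : 0 <= (q - 7 / 10 * p) ^+ 2 * (q + 7 / 5 * p).
  by rewrite mulr_ge0 ?sqr_ge0 // addr_ge0 // mulr_ge0 //; lra.
have p3 : 0 <= p ^+ 3 by rewrite exprn_ge0.
have p2q : 0 <= p ^+ 2 * q by rewrite mulr_ge0 ?sqr_ge0.
have form0 :
    0 <= gamma * (3 / 2 * p ^+ 3 - 5 / 2 * p ^+ 2 * q + 16 / 9 * q ^+ 3).
  by rewrite mulr_ge0 ?(ltW gamma_gt0) //; lra.
have gp2 : 0 <= gamma / 2 * p ^+ 2 by rewrite mulr_ge0 ?sqr_ge0 //; lra.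
have gp : 0 <= 2 * gamma * p by rewrite mulr_ge0 //; lra.
have t1 := ler_wpM2l gp2 r_le.
have t2 := ler_wpM2l gp hd_le.
lra.
Qed.
End CubicStep.

(** * The coefficients of the method *)

Section Coefficients.
Variable R : realType.
Implicit Types (t : nat).

Lemma aprodE t : aprod R t = 6 / ((t%:R + 1) * (t%:R + 2) * (t%:R + 3)).
Proof.
elim: t => [|t IH]; first by rewrite /aprod big_geq //; field.
rewrite /aprod big_nat_recr //= -/(aprod R t) IH /alpha -natr1.
have t0 : (0 : R) <= t%:R by [].
field; do ?(apply/andP; split); rewrite gt_eqF //; lra.
Qed.

Lemma aprod_gt0 t : 0 < aprod R t.
Proof.
have t0 : (0 : R) <= t%:R by [].
by rewrite aprodE divr_gt0 // !mulr_gt0 //; lra.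
Qed.

Lemma aprodS t : aprod R t.+1 = aprod R t * (1 - alpha R t.+1).
Proof. by rewrite /aprod big_nat_recr. Qed.

Lemma alpha_itv t : 0 < alpha R t <= 1.
Proof.
have t0 : (0 : R) <= t%:R by [].
by rewrite /alpha divr_gt0 ?ler_pdivrMr //=; lra.
Qed.

(** This and [alpha_sqr_le] are the inequalities by which the growth of the
estimating function absorbs the terms in [|d|^3] and [|d|^2] of
[cubic_step_progress]. *)
Lemma alpha_cube_le t : 2 / 9 * alpha R t ^+ 3 <= aprod R t.
Proof.
have t0 : (0 : R) <= t%:R by [].
rewrite aprodE /alpha -subr_ge0.
set s : R := t%:R in t0 *.
have -> : 6 / ((s + 1) * (s + 2) * (s + 3)) - 2 / 9 * (3 / (s + 3)) ^+ 3 =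
   6 * ((s + 3) ^+ 2 - (s + 1) * (s + 2)) / ((s + 1) * (s + 2) * (s + 3) ^+ 3).
  by field; do ?(apply/andP; split); rewrite gt_eqF //; lra.
rewrite divr_ge0 //; last by rewrite !mulr_ge0 ?exprn_ge0 //; lra.
nra.
Qed.

Lemma alpha_sqr_le t (mu : R) : 0 <= mu ->
  2 / 3 * mu * alpha R t.+1 ^+ 2 <= aprod R t.+1 * mubar mu t / 2.
Proof.
move=> mu0; have t0 : (0 : R) <= t%:R by [].
rewrite aprodE /alpha /mubar -subr_ge0 -natr1.
set s : R := t%:R in t0 *.
rewrite [X in 0 <= X](_ : _ = 6 * mu / ((s + 3) * (s + 4) ^+ 2)).
  by rewrite divr_ge0 ?mulr_ge0 ?exprn_ge0 //; lra.
by field; do ?(apply/andP; split); rewrite gt_eqF //; lra.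
Qed.

Lemma mubar_ge0 (mu : R) t : 0 <= mu -> 0 <= mubar mu t.
Proof. by move=> mu0; rewrite /mubar !mulr_ge0. Qed.

Lemma mubar_le (mu : R) t : 0 <= mu -> mubar mu t <= mubar mu t.+1.
Proof.
by move=> mu0; rewrite /mubar ler_wpM2l ?mulr_ge0 // -natr1; lra.
Qed.
End Coefficients.

(** * The estimating sequence of a stage *)

Section InnerRun.
Variables (R : realType) (n : nat) (f : 'rV[R]_n -> R) (lambda gamma mu_u : R).
Variables (x0 : 'rV[R]_n) (T : nat) (H : nat -> 'M[R]_n).
Variables (w x y : nat -> 'rV[R]_n) (mu : nat -> R).
Hypothesis gamma_gt0 : 0 < gamma.
Hypothesis lambda_ge0 : 0 <= lambda.
Hypothesis mu_u_ge0 : 0 <= mu_u.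
Hypothesis f_C2 : twice_continuously_differentiable f.
Hypothesis f_lip : lipschitz_hessian gamma f.
Hypothesis f_sc : strongly_convex lambda f.
Hypothesis run : inner_run f gamma mu_u x0 T H w x y.
Hypothesis H_approx : forall t, (t < T)%N ->
  [/\ 0 <= mu t <= mu_u,
      loewner_le ((mu t / 2) *: 1%:M) (H t - hessian f (w t))
    & loewner_le (H t - hessian f (w t)) (mu t *: 1%:M)].

Local Notation phi := (estimate f gamma mu_u x0 x).

Lemma estimateSS t u :
  phi t.+2 u = phi t.+1 u
    + (mubar mu_u t.+1 - mubar mu_u t) / 2 * enorm (u - x0) ^+ 2
    + alpha R t.+1 / aprod R t.+1
      * (f (x t.+2) + dotp (gradient f (x t.+2)) (u - x t.+2)).
Proof. by []. Qed.

(** The added linearisations only change the affine part, so [cubic_growth]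
applies to every estimating function. *)
Lemma estimate_cubic t : exists c l, forall u,
  phi t.+1 u = cubic c l (mubar mu_u t)%:M (96 * gamma) (u - x0).
Proof.
elim: t => [|t [c [l IH]]].
  exists (f (x 1%N)), 0 => u.
  by rewrite /cubic dotp0l mul_mx_scalar dotpZl -sqr_enorm /=; lra.
set k := alpha R t.+1 / aprod R t.+1; set g := gradient f (x t.+2).
exists (c + k * (f (x t.+2) + dotp g (x0 - x t.+2))), (l + k *: g) => u.
rewrite estimateSS IH /cubic !mul_mx_scalar -/k -/g.
have -> : u - x t.+2 = (u - x0) + (x0 - x t.+2) by rewrite addrA subrK.
move: (u - x0) (x0 - x t.+2) => v e.
rewrite !dotpE -!sqr_enorm.
lra.
Qed.

Lemma estimate_growth t u v : is_argmin (phi t.+1) u ->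
  phi t.+1 u + mubar mu_u t / 2 * enorm (v - u) ^+ 2
    + 8 * gamma * enorm (v - u) ^+ 3 <= phi t.+1 v.
Proof.
have [c [l phiE]] := estimate_cubic t => umin.
have g0 : 0 <= 96 * gamma by rewrite mulr_ge0 // ltW.
have cmin : is_argmin (cubic c l (mubar mu_u t)%:M (96 * gamma)) (u - x0).
  by move=> z; have := umin (x0 + z); rewrite !phiE (addrC x0) addrK.
have := cubic_growth (v - u) (tr_scalar_mx _ _) g0 cmin.
rewrite !phiE mul_mx_scalar dotpZl -sqr_enorm.
have -> : u - x0 + (v - u) = v - x0 by rewrite addrC addrA subrK.
lra.
Qed.

(** Convexity of [f] at the new point [x t.+2] turns the bound at [x t.+1] and
the new linear term of the estimating function into the inner product of
[gradient f (x t.+2)] with [w t.+1 - x t.+2 + alpha *: (u - y t.+1)]. This is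
the one that [cubic_step_progress] controls, at the price of terms that the
growth of the old estimating function around [y t.+1] provides. *)
Lemma value_le_estimate t u : (t < T)%N -> f (x t.+1) / aprod R t <= phi t.+1 u.
Proof.
elim: t u => [|t IH] u tT.
  rewrite /aprod big_geq //= divr1 -addrA lerDl.
  rewrite addr_ge0 // mulr_ge0 ?exprn_ge0 ?enorm_ge0 //.
    by rewrite divr_ge0 // mubar_ge0.
  by rewrite divr_ge0 // mulr_ge0 // ltW.
have tT' := ltnW tT.
have ymin : is_argmin (phi t.+1) (y t.+1) by apply: (run_y run); rewrite tT'.
have := estimate_growth u ymin; have := IH (y t.+1) tT'.
rewrite estimateSS aprodS.
have B0 := aprod_gt0 R t; have := alpha_cube_le R t.+1.
have := alpha_sqr_le t mu_u_ge0; have := mubar_le t mu_u_ge0.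
have := alpha_itv R t.+1; have := aprod_gt0 R t.+1; rewrite aprodS.
have wt := run_w run (t := t.+1) tT; move: wt.
move: (mubar mu_u t) (mubar mu_u t.+1) (alpha R t.+1) (aprod R t) B0.
move=> m m' a B B0 wt.
set A := B * (1 - a) => A0 /andP[a0 a1] mm' a2 a3 IHy growth.
have x2min := run_xS run (t := t.+1) tT.
have [/andP[mu0 mu_le] Hlo Hup] := H_approx tT.
have := cubic_step_progress gamma_gt0 f_C2 f_lip mu0 (run_sym run tT) Hlo Hup
  (a *: (u - y t.+1)) x2min.
have := convex_gradient_le f_C2 f_lip (x t.+2) (x t.+1 - x t.+2) lambda_ge0 f_sc.
rewrite (addrC (x t.+2)) subrK.
have -> : w t.+1 - x t.+2 + a *: (u - y t.+1) =
    (1 - a) *: (x t.+1 - x t.+2) + a *: (u - x t.+2).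
  by rewrite wt; apply/rowP => i; rewrite !mxE; ring.
rewrite (dotpDr ((1 - a) *: _)) !dotpZr enormZ (gtr0_norm a0) => cvx step.
move: (dotp _ (x t.+1 - _)) (dotp _ (u - x t.+2)) cvx step => G1 G2 cvx step.
have N0 : 0 <= enorm (u - x0) ^+ 2 by rewrite sqr_ge0.
move: (enorm_ge0 (u - y t.+1)) growth step.
move: (enorm (u - y t.+1)) (phi t.+1 _) (phi t.+1 _) IHy.
move=> r Q P IHy r0 growth step.
move: (enorm (u - x0) ^+ 2) N0 => N N0.
have AE : A = B * (1 - a) by [].
clearbody A; rewrite ler_pdivrMr // mulrDl.
have -> : a / A * (f (x t.+2) + G2) * A = a * (f (x t.+2) + G2).
  by field; rewrite gt_eqF.
have IHA : (1 - a) * f (x t.+1) <= A * P.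
  have := ler_wpM2l (ltW A0) IHy.
  suff -> : A * (f (x t.+1) / B) = (1 - a) * f (x t.+1) by [].
  by rewrite AE; field; rewrite gt_eqF.
have gA := ler_wpM2l (ltW A0) growth.
have NA : 0 <= A * ((m' - m) * N) by rewrite !mulr_ge0 ?(ltW A0) // subr_ge0.
have cA : (1 - a) * (f (x t.+2) + G1) <= (1 - a) * f (x t.+1).
  by rewrite ler_wpM2l // subr_ge0.
have quad := ler_wpM2r (sqr_ge0 r) a2.
have cub : 2 / 9 * a ^+ 3 * (8 * gamma * r ^+ 3) <= A * (8 * gamma * r ^+ 3).
  by rewrite ler_wpM2r // !mulr_ge0 ?exprn_ge0 // ltW.
have muq : mu t.+1 * (a ^+ 2 * r ^+ 2) <= mu_u * (a ^+ 2 * r ^+ 2).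
  by rewrite ler_wpM2r // mulr_ge0 ?sqr_ge0.
have muu : 0 <= mu_u * (a ^+ 2 * r ^+ 2).
  by rewrite mulr_ge0 // mulr_ge0 ?sqr_ge0.
lra.
Qed.

(** The initial [f (x 1)] is compared with [f u] by [cubic_model_min_le], which
adds [mu_u / 2] to the quadratic and [gamma / 3] to the cubic coefficient
[96 * gamma / 6]; each later linear term is a minorant of [f]. *)
Lemma estimate_le t u : (t < T)%N ->
  phi t.+1 u <= f u / aprod R t
    + (mubar mu_u t + mu_u) / 2 * enorm (u - x0) ^+ 2
    + 49 / 3 * gamma * enorm (u - x0) ^+ 3.
Proof.
elim: t => [|t IH] tT.
  have [/andP[mu0 mu_le] Hlo Hup] := H_approx tT.
  have := cubic_model_min_le f_C2 f_lip mu0 Hlo Hup (run_x1 run) u.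
  rewrite (run_w0 run) /aprod big_geq //= divr1.
  have := ler_wpM2r (sqr_ge0 (enorm (u - x0))) mu_le.
  lra.
have := IH (ltnW tT); rewrite estimateSS aprodS.
have B0 := aprod_gt0 R t; have := aprod_gt0 R t.+1; rewrite aprodS.
have /andP[a0 a1] := alpha_itv R t.+1.
have := convex_gradient_le f_C2 f_lip (x t.+2) (u - x t.+2) lambda_ge0 f_sc.
rewrite (addrC (x t.+2)) subrK.
move: (mubar mu_u t) (mubar mu_u t.+1) a0 => m m'.
move: (alpha R t.+1) (aprod R t) B0 a1 => a B B0 a1 a0 cvx A0 IHu.
have A1 : 0 < 1 - a by rewrite -(pmulr_rgt0 _ B0).
have -> : f u / (B * (1 - a)) = f u / B + a / (B * (1 - a)) * f u.
  by field; rewrite !gt_eqF.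
have := ler_wpM2l (ltW (divr_gt0 a0 A0)) cvx.
lra.
Qed.

Lemma inner_run_le u : (0 < T)%N ->
  f (x T) - f u <= aprod R T.-1
    * ((mubar mu_u T.-1 + mu_u) / 2 * enorm (u - x0) ^+ 2
       + 49 / 3 * gamma * enorm (u - x0) ^+ 3).
Proof.
move=> T0; have T1 : (T.-1 < T)%N by rewrite prednK.
have := le_trans (value_le_estimate u T1) (estimate_le u T1).
rewrite prednK //; have A0 := aprod_gt0 R T.-1.
rewrite -addrA -lerBlDl -mulrBl ler_pdivrMr // mulrC.
by rewrite (mulrC (aprod _ _)).
Qed.
End InnerRun.

(** * Restarting *)

Section Stage.
Variables (R : realType).
Implicit Types (lambda gamma mu_u r D : R) (s : nat).

(** The two arguments of the maximum, cubed and squared, with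
[8 = 2 ^ 3] and [96 = (2 * 2) ^ 2 * 6]. *)
Lemma stage_length_ge lambda gamma mu_u (R0 : R) s :
  0 < lambda -> 0 < gamma -> 0 <= mu_u -> 0 < R0 ->
  [/\ (0 < stage_length lambda gamma mu_u R0 s)%N,
      8 * 196 * gamma * radius R0 s.-1 / lambda
        <= (stage_length lambda gamma mu_u R0 s)%:R ^+ 3
    & 96 * mu_u / lambda <= (stage_length lambda gamma mu_u R0 s)%:R ^+ 2].
Proof.
move=> lam0 gam0 mu0 R00.
have r0 : 0 < radius R0 s.-1 by rewrite divr_gt0 // exprn_gt0.
rewrite /stage_length.
set q := 196 * gamma * radius R0 s.-1 / lambda.
have q0 : 0 < q by rewrite !(mulr_gt0, invr_gt0).
set p := 6 * mu_u / lambda.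
have p0 : 0 <= p by rewrite divr_ge0 ?mulr_ge0 // ltW.
have c3 : (q `^ (1 / 3)) ^+ 3 = q.
  by rewrite -powR_mulrn ?powR_ge0 // -powRrM divfK ?powRr1 // ltW.
have c2 : (p `^ (1 / 2)) ^+ 2 = p.
  by rewrite -powR_mulrn ?powR_ge0 // -powRrM divfK ?powRr1.
have c0 : 0 < q `^ (1 / 3) by rewrite powR_gt0.
have d0 : 0 <= p `^ (1 / 2) by rewrite powR_ge0.
move: (q `^ (1 / 3)) (p `^ (1 / 2)) c3 c2 c0 d0 => c d c3 c2 c0 d0.
set M := Num.max c (2 * d).
have cM : c <= M by rewrite le_max lexx.
have dM : 2 * d <= M by rewrite le_max lexx orbT.
have M0 : 0 < 2 * M by lra.
have ceil0 : 0 < Num.ceil (2 * M) by rewrite ceil_gt0.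
have := ceil_ge (2 * M).
have -> : (Num.ceil (2 * M))%:~R = (absz (Num.ceil (2 * M)))%:R :> R.
  by rewrite natr_absz gtr0_norm.
move: (absz _) => N MN.
split.
- by rewrite -(ltr0n R); lra.
- have := @lerXn2r R 3 (2 * c) N%:R.
  rewrite !nnegrE => /(_ _ _ _) H3.
  apply: le_trans (H3 _ _ _); [|lra|lra|lra].
  by rewrite exprMn c3 /q; lra.
- have := @lerXn2r R 2 (4 * d) N%:R.
  rewrite !nnegrE => /(_ _ _ _) H2.
  apply: le_trans (H2 _ _ _); [|lra|lra|lra].
  by rewrite exprMn c2 /p; lra.
Qed.

(** Since [aprod R T.-1] is [6 / (T * (T + 1) * (T + 2))], the cubic term is at
most [98 * gamma * r / T^3 * D^2] and the quadratic one at most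
[6 * mu_u / T^2 * D^2]; the two lower bounds on [T] make each of them at most
[lambda / 16 * D^2]. *)
Lemma stage_rate lambda gamma mu_u r D (T : nat) :
  0 < lambda -> 0 < gamma -> 0 <= mu_u -> 0 <= D <= r -> (0 < T)%N ->
  8 * 196 * gamma * r / lambda <= T%:R ^+ 3 ->
  96 * mu_u / lambda <= T%:R ^+ 2 ->
  aprod R T.-1 * ((mubar mu_u T.-1 + mu_u) / 2 * D ^+ 2
    + 49 / 3 * gamma * D ^+ 3) <= lambda / 8 * D ^+ 2.
Proof.
case: T => // t lam0 gam0 mu0 /andP[D0 Dr] _ /=.
rewrite !ler_pdivrMr // aprodE /mubar -[t.+1%:R]natr1.
have : (0 : R) <= t%:R by [].
move: (t%:R : R) => k k0 T3 T2.
set K := (k + 1) * (k + 2) * (k + 3).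
have K0 : 0 < K by rewrite !mulr_gt0 //; lra.
have K3 : (k + 1) ^+ 3 <= K by rewrite /K; nra.
have K2 : (2 * k + 5) * (k + 1) ^+ 2 <= 2 * K by rewrite /K; nra.
rewrite mulrAC ler_pdivrMr //.
have e3 : 98 * gamma * D <= lambda / 16 * K.
  have : gamma * D <= gamma * r by rewrite ler_wpM2l // ltW.
  have : lambda * (k + 1) ^+ 3 <= lambda * K by rewrite ler_wpM2l // ltW.
  lra.
have e2 : 3 * (2 * k + 5) * mu_u <= lambda / 16 * K.
  have k5 : 0 <= 2 * k + 5 by lra.
  have := ler_wpM2l k5 T2.
  have : lambda * ((2 * k + 5) * (k + 1) ^+ 2) <= lambda * (2 * K).
    by rewrite ler_wpM2l // ltW.
  lra.
have := ler_wpM2r (sqr_ge0 D) (lerD e3 e2).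
lra.
Qed.
End Stage.

Theorem theorem12 (R : realType) (n : nat) (f : 'rV[R]_n -> R)
    (lambda gamma mu_u R0 : R) (xstar z0 : 'rV[R]_n)
    (z : nat -> 'rV[R]_n) (H : nat -> nat -> 'M[R]_n)
    (w x y : nat -> nat -> 'rV[R]_n) (mu : nat -> nat -> R) :
  0 < gamma -> 0 < lambda -> 0 <= mu_u -> 0 < R0 ->
  twice_continuously_differentiable f ->
  lipschitz_hessian gamma f ->
  strongly_convex lambda f ->
  is_argmin f xstar ->
  enorm (z0 - xstar) <= R0 ->
  multistage_run f z0 lambda gamma mu_u R0 z H w x y ->
  (forall s t : nat, (0 < s)%N ->
    (t < stage_length lambda gamma mu_u R0 s)%N ->
    [/\ 0 <= mu s t <= mu_u,
        loewner_le ((mu s t / 2) *: 1%:M) (H s t - hessian f (w s t))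
      & loewner_le (H s t - hessian f (w s t)) (mu s t *: 1%:M)]) ->
  forall s : nat,
    enorm (z s - xstar) ^+ 2 <= (1 / 2) ^+ s * R0 ^+ 2 /\
    f (z s) - f xstar <= (1 / 4) ^+ s * (f z0 - f xstar).
Proof.
move=> gam0 lam0 mu0 R00 fC2 flip fsc xmin zR [z00 stages] Happrox.
have radiusS s : radius R0 s.+1 = radius R0 s / 2.
  by rewrite /radius exprSr invfM mulrA.
have radius0 s : 0 < radius R0 s by rewrite divr_gt0 // exprn_gt0.
have main s : enorm (z s - xstar) <= radius R0 s /\
    f (z s) - f xstar <= (1 / 4) ^+ s * (f z0 - f xstar).
  elim: s => [|s [dist val]].
    by rewrite z00 /radius !expr0 divr1 mul1r.
  have [run zE] := stages s.+1 isT.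
  have [T0 T3 T2] := stage_length_ge s.+1 lam0 gam0 mu0 R00.
  have D0 : 0 <= enorm (z s - xstar) <= radius R0 s by rewrite enorm_ge0.
  have := inner_run_le gam0 (ltW lam0) mu0 fC2 flip fsc run
    (fun t tT => Happrox s.+1 t isT tT) xstar T0.
  have := stage_rate lam0 gam0 mu0 D0 T0 T3 T2.
  rewrite -zE /= (enormB xstar) => rate bound.
  have dec := le_trans bound rate.
  have growS := strongly_convex_growth (z s.+1) fsc xmin.
  have grow := strongly_convex_growth (z s) fsc xmin.
  split; last by rewrite exprS; lra.
  rewrite radiusS.
  have d2 : enorm (z s.+1 - xstar) ^+ 2 <= (enorm (z s - xstar) / 2) ^+ 2.
    rewrite -(ler_pM2l lam0); lra.
  rewrite ler_pXn2r ?nnegrE ?divr_ge0 ?enorm_ge0 // in d2.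
  lra.
move=> s; have [dist val] := main s; split => //.
apply: (@le_trans _ _ (radius R0 s ^+ 2)).
  by rewrite ler_pXn2r ?nnegrE ?enorm_ge0 // ltW.
rewrite /radius exprMn mulrC ler_wpM2r ?sqr_ge0 //.
rewrite div1r exprVn -exprVn -exprM mulnC exprM.
by rewrite lerXn2r ?nnegrE ?exprn_ge0 ?invr_ge0 //; lra.
Qed.
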